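(* Let $\sigma(x)=x\Phi(x)$ be the GeLU activation. Then for all $\mu\in\mathbb R$ and $\nu\ge0$, $$M_\sigma(\mu;\nu)=\frac{\nu}{\sqrt{1+\nu}}\,\phi\!\left(\frac{\mu}{\sqrt{1+\nu}}\right)+\mu\,\Phi\!\left(\frac{\mu}{\sqrt{1+\nu}}\right).$$
   Context: $\Phi$ and $\phi=\Phi'$ are the standard normal CDF and density. $M_\sigma(\mu;\nu):=\mathbb E\,\sigma(X)$ where $X\sim\mathcal N(\mu,\nu)$ ($\nu$ is the variance). *)

(* Defs.v *)
From HB Require Import structures.
From mathcomp Require Import all_boot all_order all_algebra.
From mathcomp Require Import all_classical all_reals all_analysis.
From mathcomp Require Import measurable_realfun.

Set Implicit Arguments.
Unset Strict Implicit.
Unset Printing Implicit Defensive.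
Import Order.TTheory GRing.Theory Num.Theory.
Import numFieldNormedType.Exports.
Local Open Scope classical_set_scope.
Local Open Scope ring_scope.

Section gaussian.
Context {R : realType}.
Implicit Types (mu nu x : R) (sigma : R -> R).

(* [normal_prob] takes a standard deviation, and [normal_prob mu 0] is the
   uniform law on [0, 1]; the degenerate law N(mu, 0) is the Dirac mass at mu. *)
Definition gaussian_law mu nu : probability (measurableTypeR R) R :=
  if 0 < nu then [the probability _ _ of normal_prob mu (Num.sqrt nu)]
  else [the probability _ _ of @dirac _ (measurableTypeR R) mu R].

Definition std_normal_pdf : R -> R := normal_pdf 0 1.

Definition std_normal_cdf x : R := fine (normal_prob 0 1 `]-oo, x]).

Lemma derive1_std_normal_cdf : (std_normal_cdf^`())%classic = std_normal_pdf.
Proof.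
apply/funext => x.
have /= [] // := @continuous_FTC1 R std_normal_pdf -oo%O x (x + 1).
- by rewrite ltrDl.
- by apply: (integrableS _ _ (subsetT _)) => //; exact: integrable_normal_pdf.
- by rewrite ltNyr.
- by move: x; apply: (@continuous_normal_pdf R 0 1); rewrite oner_eq0.
Qed.

(* The sample space is R itself, with X the identity; [gaussian_meanE] below
   shows that any other X with law N(mu, nu) gives the same value. *)
Definition gaussian_mean sigma mu nu : \bar R :=
  'E_(gaussian_law mu nu)[sigma]%E.

Definition gelu x : R := x * std_normal_cdf x.

Lemma gaussian_meanE sigma mu nu d (T : measurableType d) (P : probability T R)
    (X : {RV P >-> measurableTypeR R}) :
  measurable_fun [set: measurableTypeR R] sigma ->
  distribution P X = gaussian_law mu nu :> (set _ -> _) ->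
  gaussian_mean sigma mu nu = 'E_P[sigma \o X]%E.
Proof.
move=> ms lawX; rewrite /gaussian_mean unlock.
rewrite (eq_measure_integral (distribution P X)) => [|A _ _].
have mE : measurable_fun [set: measurableTypeR R] (EFin \o sigma).
  exact/measurable_EFinP.
rewrite integralE [RHS]integralE; congr (_ - _)%E.
- rewrite (ge0_integral_distribution X (measurable_funepos mE))//.
  by rewrite (funepos_comp (EFin \o sigma) X).
- rewrite (ge0_integral_distribution X (measurable_funeneg mE))//.
  by rewrite (funeneg_comp (EFin \o sigma) X).
- exact: (esym (congr1 (@^~ A) lawX)).
Qed.

End gaussian.

(* Main.v *)
(** Write X = mu + (X - mu) with X ~ N(mu, nu), s = sqrt nu and p the density
    of X.
    - E[Phi(X)] is the probability that Z <= X for an independent standard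
      normal Z; integrating out X first (Tonelli, with Z = X + u) leaves the
      mass that N(- mu, 1 + nu) gives to u <= 0.
    - E[(X - mu) Phi(X)] follows Stein: (x - mu) p is the derivative of
      - nu p, so exchanging the integrals over x and z <= x gives
      nu times the integral of p phi.
    In both cases the remaining integral over x is that of a product of two
    normal densities, which is a constant multiple of a normal density. *)
Require Import Defs.
From HB Require Import structures.
From mathcomp Require Import all_boot all_order all_algebra.
From mathcomp Require Import all_classical all_reals all_analysis.
From mathcomp Require Import measurable_realfun ring.
Import Order.TTheory GRing.Theory Num.Theory.
Import numFieldNormedType.Exports.
Local Open Scope ring_scope.

Section normal_density.
Local Open Scope classical_set_scope.
Context {R : realType}.
Implicit Types m s x y a b : R.
Local Notation mu := (@lebesgue_measure R).

(** * Reflection, scaling and products of normal densities *)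

Lemma normal_pdfC m s x : s != 0 -> normal_pdf m s x = normal_pdf x s m.
Proof. by move=> s0; rewrite !normal_pdfE// /normal_fun -sqrrN opprB. Qed.

Lemma normal_pdfN m s x : s != 0 -> normal_pdf (- m) s x = normal_pdf m s (- x).
Proof.
by move=> s0; rewrite !normal_pdfE// /normal_fun -sqrrN opprB addrC.
Qed.

Lemma normal_pdf_scale m s x : 0 < s ->
  normal_pdf m s x = normal_pdf 0 1 ((x - m) / s) / s.
Proof.
move=> s0; rewrite !normal_pdfE ?gt_eqF// /normal_peak /normal_fun subr0.
rewrite expr1n mul1r -mulrnAr sqrtrM ?sqr_ge0// sqrtr_sqr gtr0_norm// invfM.
rewrite -mulrA mulrC; congr (_ * expR _ / _).
by field; rewrite gt_eqF.
Qed.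

(** Completing the square in [x]: the new mean is the precision-weighted average of [m1] and [m2],
    precisions add, and the leftover factor is free of [x]. Integrals of products thus reduce to the
    total mass of one density. *)
Lemma normal_pdfM m1 s1 m2 s2 x (s := Num.sqrt (s1 ^+ 2 + s2 ^+ 2)) :
  0 < s1 -> 0 < s2 ->
  normal_pdf m1 s1 x * normal_pdf m2 s2 x =
  normal_pdf m1 s m2 *
  normal_pdf ((m1 * s2 ^+ 2 + m2 * s1 ^+ 2) / s ^+ 2) (s1 * s2 / s) x.
Proof.
move=> s1_gt0 s2_gt0.
have s_gt0 : 0 < s by rewrite sqrtr_gt0 addr_gt0// exprn_gt0.
have ss : s ^+ 2 = s1 ^+ 2 + s2 ^+ 2 by rewrite sqr_sqrtr// addr_ge0// sqr_ge0.
(* Isolating sqrt(2 pi) turns the comparison of constants into a rational identity that [field] can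
   settle. *)
have peakE a : 0 < a -> normal_peak a = (Num.sqrt (pi *+ 2))^-1 / a :> R.
  move=> a0; rewrite /normal_peak -mulrnAr sqrtrM ?sqr_ge0// sqrtr_sqr.
  by rewrite gtr0_norm// invfM mulrC.
rewrite !normal_pdfE ?gt_eqF ?divr_gt0 ?mulr_gt0// /normal_fun.
rewrite !peakE ?divr_gt0 ?mulr_gt0// mulrACA [RHS]mulrACA -!expRD.
have spi : Num.sqrt (pi *+ 2) != 0 :> R.
  by rewrite gt_eqF// sqrtr_gt0 pmulrn_lgt0// pi_gt0.
congr (_ * expR _).
  by field; rewrite spi !gt_eqF.
rewrite exprMn exprVn exprMn ss.
by field; rewrite -ss !expf_neq0 ?gt_eqF// !gt_eqF.
Qed.

Lemma integrable_normal_pdfM m1 s1 m2 s2 : 0 < s1 -> 0 < s2 ->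
  mu.-integrable setT (fun x => (normal_pdf m1 s1 x * normal_pdf m2 s2 x)%:E).
Proof.
move=> s1_gt0 s2_gt0; under eq_fun do rewrite normal_pdfM// EFinM.
by apply: integrableZl => //; exact: integrable_normal_pdf.
Qed.

Lemma integral_normal_pdfM m1 s1 m2 s2 : 0 < s1 -> 0 < s2 ->
  (\int[mu]_x (normal_pdf m1 s1 x * normal_pdf m2 s2 x)%:E =
   (normal_pdf m1 (Num.sqrt (s1 ^+ 2 + s2 ^+ 2)) m2)%:E)%E.
Proof.
move=> s1_gt0 s2_gt0; under eq_integral do rewrite normal_pdfM// EFinM.
rewrite integralZl//; last exact: integrable_normal_pdf.
by rewrite integral_normal_pdf mule1.
Qed.

(** * Integration against a normal law, and the standard normal CDF *)

(** The Radon-Nikodym derivative and the density have equal integrals over every measurable set,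
    hence agree almost everywhere. This settles nonnegative integrands; the general case follows on
    positive and negative parts, with no integrability needed. *)
Lemma integral_normal_prob m s (f : R -> \bar R) : measurable_fun setT f ->
  (\int[normal_prob m s]_x f x = \int[mu]_x (f x * (normal_pdf m s x)%:E))%E.
Proof.
have ge0_int g : measurable_fun setT g -> (forall x, 0 <= g x)%E ->
    (\int[normal_prob m s]_x g x = \int[mu]_x (g x * (normal_pdf m s x)%:E))%E.
  move=> mg g0.
  have dom := normal_prob_dominates m s.
  rewrite -(Radon_Nikodym_SigmaFinite.change_of_variables dom g0)//.
  have RN := Radon_Nikodym_SigmaFinite.f_integrable dom.
  have mpdf : measurable_fun setT (EFin \o normal_pdf m s).
    by apply/measurable_EFinP; exact: measurable_normal_pdf.
  apply: ae_eq_integral => //.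
  - by apply: emeasurable_funM => //; exact: measurable_int RN.
  - exact: emeasurable_funM.
  - apply: ae_eqe_mul2l; apply: integral_ae_eq => //= E _ mE.
    by rewrite -Radon_Nikodym_SigmaFinite.f_integral.
move=> mf; rewrite integralE [RHS]integralE.
have pdf0 x : (0 <= (normal_pdf m s x)%:E)%E by rewrite lee_fin normal_pdf_ge0.
congr (_ - _)%E.
- rewrite ge0_int//; last exact: measurable_funepos.
  (* The density is nonnegative, so it factors out of the maximum with 0. *)
  by apply: eq_integral => x _; rewrite !funeposE maxe_pMl// mul0e.
- rewrite ge0_int//; last exact: measurable_funeneg.
  by apply: eq_integral => x _; rewrite !funenegE maxe_pMl// mul0e mulNe.
Qed.

Lemma std_normal_cdfE x : (std_normal_cdf x)%:E = normal_prob 0 1 `]-oo, x].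
Proof. by rewrite /std_normal_cdf fineK// fin_num_measure. Qed.

Lemma measurable_std_normal_cdf :
  measurable_fun [set: measurableTypeR R] (@std_normal_cdf R).
Proof.
apply: nondecreasing_measurable => // x y xy.
rewrite -lee_fin !std_normal_cdfE le_measure ?inE//=.
by apply: subset_itvl; rewrite bnd_simp.
Qed.

Lemma std_normal_cdf_ge0 x : 0 <= std_normal_cdf x.
Proof. by rewrite -lee_fin std_normal_cdfE. Qed.

Lemma std_normal_cdf_le1 x : std_normal_cdf x <= 1.
Proof. by rewrite -lee_fin std_normal_cdfE probability_le1. Qed.

(** Standardization by the increasing affine map [F]. It is also used from right to left, to read a
    value of Phi as the mass of a half-line. *)
Lemma normal_prob_itvNyc m s b : 0 < s ->
  normal_prob m s `]-oo, b] = (std_normal_cdf ((b - m) / s))%:E.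
Proof.
move=> s0; rewrite std_normal_cdfE /normal_prob.
pose F y : R := (y - m) / s.
have dF y : is_derive y 1 F s^-1.
  have -> : F = s^-1 *: (id - cst m) :> (R -> R).
    by apply/funext => z; rewrite /F mulrC.
  by apply: is_derive_eq; rewrite subr0 [LHS]mulr1.
have F'E : F^`()%classic = cst s^-1.
  by apply/funext => y; rewrite derive1E; apply: derive_val.
have cF y : {for y, continuous F}.
  by apply/differentiable_continuous/derivable1_diffP; case: (dF y).
rewrite (@increasing_ge0_integration_by_substitutionNy _ F _ b).
- apply: eq_integral => y _; congr EFin.
  by rewrite F'E normal_pdf_scale.
- by move=> x y _ _ xy; rewrite /F ltr_pM2r ?invr_gt0// ltrD2r.
- by rewrite F'E => y _; exact: cvg_cst.
- by rewrite F'E; exact: is_cvg_cst.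
- by rewrite F'E; exact: cvg_cst.
- split => [y _|]; first by case: (dF y).
  exact: cvg_at_left_filter (cF b).
- by apply/gt0_cvgMlNy; [rewrite invr_gt0|exact: cvg_addrr_Ny].
- apply: continuous_subspaceT; apply: continuous_normal_pdf.
  by rewrite oner_eq0.
- by move=> y _; exact: normal_pdf_ge0.
Qed.

(** * Derivative and decay of the density, and its centred first moment *)

Lemma is_derive_normal_pdf m s x : s != 0 ->
  is_derive x 1 (normal_pdf m s) (- ((x - m) / s ^+ 2) * normal_pdf m s x).
Proof.
move=> s0; rewrite normal_pdfE//.
pose g y : R := - (y - m) ^+ 2 / (s ^+ 2 *+ 2).
have dg : is_derive x 1 g (- ((x - m) / s ^+ 2)).
  have -> : g = - (s ^+ 2 *+ 2)^-1 *: (id - cst m) ^+ 2 :> (R -> R).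
    by apply/funext => y; rewrite /g mulNr mulrC -mulNr.
  apply: is_derive_eq; rewrite !fctE /GRing.scale/=.
  by field.
have -> : (fun y => normal_peak s * normal_fun m s y) =
    normal_peak s *: (expR \o g) by [].
apply: is_derive_eq; rewrite /GRing.scale/= /normal_fun.
by rewrite -/(g x); ring.
Qed.

Lemma cvg_normal_pdfy m s : 0 < s -> normal_pdf m s x @[x --> +oo] --> 0.
Proof.
move=> s0; rewrite normal_pdfE ?gt_eqF// -(mulr0 (normal_peak s)).
apply: cvgMr.
have q0 : 0 < Num.sqrt (s ^+ 2 *+ 2).
  by rewrite sqrtr_gt0 pmulrn_lgt0// exprn_gt0.
have -> : normal_fun m s =
    gauss_fun \o (fun x => (x - m) / Num.sqrt (s ^+ 2 *+ 2)).
  apply/funext => x; rewrite /normal_fun /gauss_fun/= exprMn exprVn.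
  by rewrite sqr_sqrtr ?mulNr// pmulrn_lge0// sqr_ge0.
apply: cvg_comp cvg_gauss_fun.
by apply/gt0_cvgMly; [rewrite invr_gt0|exact: cvg_addrr].
Qed.

(* Since y <= s (1 + y^2 / (4 s^2)) <= s exp (y^2 / (4 s^2)), the integrand is
   dominated by a multiple of the density of N(m, 2 s^2). *)
Lemma integrable_normal_moment m s : 0 < s ->
  mu.-integrable setT (fun x => ((x - m) * normal_pdf m s x)%:E).
Proof.
move=> s0; pose r := s * Num.sqrt 2.
have r0 : 0 < r by rewrite mulr_gt0// sqrtr_gt0.
pose c := s * normal_peak s / normal_peak r.
have c0 : 0 <= c by rewrite !mulr_ge0 ?invr_ge0 ?normal_peak_ge0// ltW.
have rr : r ^+ 2 = s ^+ 2 * 2 by rewrite exprMn sqr_sqrtr.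
apply: (@le_integrable _ _ _ mu _ _ _
  (fun x => (c%:E * (normal_pdf m r x)%:E)%E)) => //.
- apply/measurable_EFinP; apply: measurable_funM.
    by apply: measurable_funB.
  exact: measurable_normal_pdf.
- move=> x _; rewrite /= lee_fin normrM (ger0_norm (normal_pdf_ge0 _ _ _)).
  rewrite [leRHS]ger0_norm; last by rewrite mulr_ge0 ?normal_pdf_ge0.
  rewrite !normal_pdfE ?gt_eqF// /c [leRHS]mulrA divfK; last first.
    by rewrite gt_eqF// normal_peak_gt0// gt_eqF.
  rewrite mulrCA [leRHS]mulrAC [leRHS]mulrC ler_wpM2l ?normal_peak_ge0//.
  set w := (x - m) ^+ 2 / (r ^+ 2 *+ 2).
  have -> : normal_fun m r x = expR w * normal_fun m s x.
    by rewrite /normal_fun -expRD /w rr; congr expR; field; rewrite gt_eqF.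
  rewrite mulrA ler_wpM2r ?normal_fun_ge0//.
  rewrite (@le_trans _ _ (s * (1 + w)))//; last first.
    by rewrite ler_wpM2l ?expR_ge1Dx// ltW.
  rewrite /w rr -(real_normK (num_real (x - m))).
  set y := `|_|.
  (* With [y] = |x - m|, the gap s (1 + y^2 / (4 s^2)) - y is a perfect square over 4 s. *)
  rewrite -subr_ge0 (_ : _ - _ = (y - s *+ 2) ^+ 2 / (s *+ 4)).
    by rewrite divr_ge0 ?sqr_ge0// mulrn_wge0// ltW.
  by field; rewrite gt_eqF.
- by apply: integrableZl => //; exact: integrable_normal_pdf.
Qed.

(** The antiderivative [F] = - s^2 p vanishes at +oo, so only the boundary term at [a] survives.
    This is the inner integral over x >= z in the Stein exchange. *)
Lemma integral_normal_tail_moment m s a : 0 < s ->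
  (\int[mu]_(x in `[a, +oo[) ((x - m) * normal_pdf m s x)%:E =
   (s ^+ 2 * normal_pdf m s a)%:E)%E.
Proof.
move=> s0; pose F y := - s ^+ 2 * normal_pdf m s y.
have dF y : is_derive y 1 F ((y - m) * normal_pdf m s y).
  have dp := @is_derive_normal_pdf m s y (lt0r_neq0 s0).
  have -> : F = - s ^+ 2 *: normal_pdf m s by [].
  by apply: is_derive_eq; rewrite /GRing.scale/=; field; rewrite gt_eqF.
have cF : continuous F.
  by move=> y; apply/differentiable_continuous/derivable1_diffP; case: (dF y).
have cf : continuous (fun y => (y - m) * normal_pdf m s y).
  move=> y; apply: cvgM; last by apply: continuous_normal_pdf; rewrite gt_eqF.
  by apply: cvgB; [exact: cvg_id|exact: cvg_cst].
have Fy : F x @[x --> +oo] --> 0.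
  by rewrite -(mulr0 (- s ^+ 2)); apply: cvgMr; exact: cvg_normal_pdfy.
have F'E : F^`()%classic = (fun y => (y - m) * normal_pdf m s y).
  by apply/funext => y; rewrite derive1E; apply: derive_val.
(* FTC on a half-line needs an integrand of constant sign, so the tail is
   split at m. *)
have above b : m <= b -> (\int[mu]_(x in `[b, +oo[)
    ((x - m) * normal_pdf m s x)%:E = (s ^+ 2 * normal_pdf m s b)%:E)%E.
  move=> mb; rewrite (@ge0_continuous_FTC2y _ _ F b 0)//.
  - by rewrite -EFinB sub0r /F mulNr opprK.
  - move=> x bx; rewrite mulr_ge0 ?normal_pdf_ge0// subr_ge0.
    exact: le_trans bx.
  - exact: continuous_subspaceT.
  - exact/cvg_at_right_filter/cF.
  - by move=> x _; rewrite F'E.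
have [ma|am] := leP m a; first exact: above.
rewrite (@itv_bndbnd_setU _ _ _ (BLeft m)) ?bnd_simp//; last exact: ltW.
rewrite integral_setU//=; last 2 first.
- by apply/measurable_EFinP/measurable_funTS; exact: continuous_measurable_fun.
- apply/disj_setPS => x/= []; rewrite !in_itv/= andbT => /andP[_ xm] mx.
  by move: (lt_le_trans xm mx); rewrite ltxx.
rewrite above// integral_itv_bndo_bndc; last first.
  by apply/measurable_EFinP/measurable_funTS; exact: continuous_measurable_fun.
rewrite (@continuous_FTC2 _ _ F)//.
- by rewrite -!EFinB -EFinD /F; congr EFin; ring.
- exact: continuous_subspaceT.
- split => [x _||]; first by case: (dF x).
    exact/cvg_at_right_filter/cF.
  exact/cvg_at_left_filter/cF.
- by move=> x _; rewrite F'E.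
Qed.

(** * The expectations of Phi(X) and (X - m) Phi(X) *)

Lemma integral_normal_pdf_cdf m s : 0 < s ->
  (\int[mu]_x (normal_pdf m s x * std_normal_cdf x)%:E =
   (std_normal_cdf (m / Num.sqrt (s ^+ 2 + 1)))%:E)%E.
Proof.
move=> s0; have s2 : 0 < s ^+ 2 + 1 by rewrite addr_gt0// exprn_gt0.
have shift x u : normal_pdf 0 1 (x + u) = normal_pdf (- x) 1 u.
  by rewrite [RHS]normal_pdf_scale// opprK !divr1 addrC.
(* The second coordinate is u = Z - x, so the constraint u <= 0 does not involve x and passes
   unchanged through the exchange of integrals. *)
pose f (z : measurableTypeR R * measurableTypeR R) :=
  (if z.2 <= 0 then normal_pdf m s z.1 * normal_pdf 0 1 (z.1 + z.2) else 0)%:E.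
have mf : measurable_fun setT f.
  apply/measurable_EFinP; apply: measurable_fun_ifT => //.
    exact: measurable_fun_ler.
  apply: measurable_funM.
    by apply: measurableT_comp => //; exact: measurable_normal_pdf.
  apply: (measurableT_comp (measurable_normal_pdf 0 1)).
  exact: measurable_funD.
have f0 z : (0 <= f z)%E.
  by rewrite /f; case: ifP => _ //; rewrite lee_fin mulr_ge0 ?normal_pdf_ge0.
transitivity (\int[mu]_x \int[mu]_u f (x, u))%E.
  apply: eq_integral => x _; rewrite EFinM.
  (* Phi(x) is put in the form Phi((0 - (- x)) / 1), the mass that N(- x, 1) gives to u <= 0. *)
  rewrite -[X in std_normal_cdf X]opprK -[X in std_normal_cdf X]add0r.
  rewrite -[X in std_normal_cdf X]divr1 -normal_prob_itvNyc//.
  rewrite /normal_prob -integralZl//; last first.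
    by apply: (integrableS measurableT) => //; exact: integrable_normal_pdf.
  rewrite integral_mkcond; apply: eq_integral => u _.
  rewrite patchE /f/= mem_setE in_itv/= shift.
  by case: ifP.
rewrite (@fubini_tonelli _ _ _ _ _ mu mu f)//.
have -> : m / Num.sqrt (s ^+ 2 + 1) = (0 - - m) / Num.sqrt (s ^+ 2 + 1).
  by rewrite sub0r opprK.
rewrite -normal_prob_itvNyc ?sqrtr_gt0// /normal_prob [RHS]integral_mkcond.
apply: eq_integral => u _; rewrite patchE mem_setE in_itv/= /f/=.
case: ifP => _; last by rewrite integral0.
(* Here [shift] is used with the roles swapped: phi(x + u) is the density of N(- u, 1) at x, so the
   integrand is a product of two densities in x. *)
under eq_integral => x _ do rewrite (addrC x) shift.
rewrite integral_normal_pdfM// expr1n normal_pdfN//.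
by rewrite gt_eqF// sqrtr_gt0.
Qed.

(** Domination by the first moment, as 0 <= Phi <= 1. It supplies the absolute integrability for the
    Fubini exchange. *)
Lemma integrable_normal_moment_cdf m s : 0 < s ->
  mu.-integrable setT
    (fun x => ((x - m) * normal_pdf m s x * std_normal_cdf x)%:E).
Proof.
move=> s0; apply: le_integrable (integrable_normal_moment m s s0) => //.
- apply/measurable_EFinP; apply: measurable_funM.
    have := measurable_int mu (integrable_normal_moment m s s0).
    by move/measurable_EFinP.
  exact: measurable_std_normal_cdf.
- move=> x _; rewrite /= lee_fin normrM ler_piMr//.
  by rewrite ger0_norm ?std_normal_cdf_ge0// std_normal_cdf_le1.
Qed.

Lemma integral_normal_moment_cdf m s : 0 < s ->
  (\int[mu]_x ((x - m) * normal_pdf m s x * std_normal_cdf x)%:E =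
   (s ^+ 2 * normal_pdf m (Num.sqrt (s ^+ 2 + 1)) 0)%:E)%E.
Proof.
move=> s0; pose g x := (x - m) * normal_pdf m s x.
pose f (z : measurableTypeR R * measurableTypeR R) :=
  (if z.2 <= z.1 then g z.1 * normal_pdf 0 1 z.2 else 0)%:E.
have gi : mu.-integrable setT (EFin \o g) by exact: integrable_normal_moment.
have mg : measurable_fun [set: measurableTypeR R] g.
  by apply/measurable_EFinP; exact: measurable_int gi.
have mf : measurable_fun setT f.
  apply/measurable_EFinP; apply: measurable_fun_ifT => //.
    exact: measurable_fun_ler.
  apply: measurable_funM; first exact: measurableT_comp mg _.
  by apply: measurableT_comp => //; exact: measurable_normal_pdf.
have cdfZ c x : (\int[mu]_(z in `]-oo, x]) (c * normal_pdf 0 1 z)%:E =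
    (c * std_normal_cdf x)%:E)%E.
  under eq_integral do rewrite EFinM.
  rewrite integralZl//; last first.
    by apply: (integrableS measurableT) => //; exact: integrable_normal_pdf.
  by rewrite EFinM std_normal_cdfE.
(* The factor x - m changes sign, so Tonelli does not apply to [f] itself. Integrating |f| over z
   first gives |x - m| p(x) Phi(x), whose integral is finite. *)
have fi : (mu \x mu)%E.-integrable setT f.
  apply/integrable12ltyP => //.
  have /integrableP[_] := integrable_normal_moment_cdf m s s0.
  apply: le_lt_trans; rewrite le_eqVlt; apply/orP; left; apply/eqP.
  apply: eq_integral => x _.
  rewrite [RHS]/= normrM (ger0_norm (std_normal_cdf_ge0 _)) -cdfZ.
  rewrite [RHS]integral_mkcond; apply: eq_integral => z _.
  rewrite patchE mem_setE in_itv/=; case: ifP => _; last by rewrite normr0.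
  by rewrite normrM (ger0_norm (normal_pdf_ge0 _ _ _)).
transitivity (\int[mu]_x \int[mu]_z f (x, z))%E.
  apply: eq_integral => x _; rewrite -cdfZ integral_mkcond.
  by apply: eq_integral => z _; rewrite patchE mem_setE in_itv/= /f; case: ifP.
rewrite (Fubini fi).
(* With z fixed, z <= x becomes the half-line [z, +oo[ in x, where the tail moment applies. *)
transitivity (\int[mu]_z ((s ^+ 2)%:E *
    (normal_pdf m s z * normal_pdf 0 1 z)%:E))%E.
  apply: eq_integral => z _.
  transitivity (\int[mu]_(x in `[z, +oo[) ((g x)%:E * (normal_pdf 0 1 z)%:E))%E.
    rewrite [RHS]integral_mkcond; apply: eq_integral => x _.
    by rewrite patchE mem_setE in_itv/= andbT /f; case: ifP.
  rewrite integralZr//; last exact: (integrableS measurableT) gi.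
  by rewrite integral_normal_tail_moment// -!EFinM mulrA.
rewrite integralZl//; last exact: integrable_normal_pdfM.
by rewrite integral_normal_pdfM// expr1n -EFinM.
Qed.

(** * The closed formula for [gelu] *)

Lemma measurable_gelu : measurable_fun [set: measurableTypeR R] (@gelu R).
Proof.
by apply: measurable_funM => //; exact: measurable_std_normal_cdf.
Qed.

End normal_density.

Theorem lemmaD1 (R : realType) (mu nu : R) (nu_ge0 : 0 <= nu) :
  gaussian_mean gelu mu nu =
    (nu / Num.sqrt (1 + nu) * std_normal_pdf (mu / Num.sqrt (1 + nu))
     + mu * std_normal_cdf (mu / Num.sqrt (1 + nu)))%:E.
Proof.
have mgelu : measurable_fun setT (EFin \o @gelu R).
  by apply/measurable_EFinP; exact: measurable_gelu.
rewrite /gaussian_mean unlock /gaussian_law.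
move: nu_ge0; rewrite le_eqVlt => /predU1P[<-|nu_gt0].
  (* For zero variance the law is the Dirac mass at [mu]; the first summand vanishes and the second
     is [gelu mu]. *)
  rewrite ltxx integral_dirac// diracT mul1e.
  by rewrite addr0 sqrtr1 !mul0r divr1 add0r.
rewrite nu_gt0 integral_normal_prob//.
have s_gt0 : 0 < Num.sqrt nu by rewrite sqrtr_gt0.
have t_gt0 : 0 < Num.sqrt (1 + nu) by rewrite sqrtr_gt0 addr_gt0.
have s2 : Num.sqrt nu ^+ 2 = nu by rewrite sqr_sqrtr// ltW.
set p := normal_pdf mu (Num.sqrt nu).
have pPhi_int : lebesgue_measure.-integrable setT
    (fun x => (p x * std_normal_cdf x)%:E).
  apply: le_integrable (integrable_normal_pdf mu (Num.sqrt nu)) => //.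
    apply/measurable_EFinP; apply: measurable_funM.
      exact: measurable_normal_pdf.
    exact: measurable_std_normal_cdf.
  move=> x _; rewrite /= lee_fin normrM ler_piMr//.
  by rewrite ger0_norm ?std_normal_cdf_ge0// std_normal_cdf_le1.
transitivity (\int[lebesgue_measure]_x
    (((x - mu) * p x * std_normal_cdf x)%:E +
     mu%:E * (p x * std_normal_cdf x)%:E))%E.
  by apply: eq_integral => x _; rewrite /= /gelu; congr EFin; ring.
rewrite integralD//; [|exact: integrable_normal_moment_cdf|exact: integrableZl].
rewrite integralZl// integral_normal_moment_cdf// integral_normal_pdf_cdf//.
rewrite s2 [nu + 1]addrC -EFinM -EFinD; congr (_ + _)%:E.
(* The density of N(mu, 1 + nu) at 0 is phi(- mu / sqrt(1 + nu)) / sqrt(1 + nu); evenness of phi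
   removes the sign. *)
rewrite normal_pdf_scale// sub0r mulNr -normal_pdfN ?oner_eq0// oppr0.
by rewrite mulrA mulrAC.
Qed.
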